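(* Consider the indefinite kernel regression model and the KernelSAM iterates described in the context, with $h_0^{\mathrm{SAM}}=0$, and let $u=U^T\bar w$. Then for every integer $k\ge0$, $\mathrm{Var}(w_k^{\mathrm{SAM}})=\mathrm{Var}^+(w_k^{\mathrm{SAM}})+\mathrm{Var}^-(w_k^{\mathrm{SAM}})$, where $$\mathrm{Bias}^2(w_k^{\mathrm{SAM}})=\frac1n\sum_{i=1}^n(1-\eta d_i-\eta\rho d_i^2)^{2k}d_i^2u_i^2,$$ $$\mathrm{Var}^+(w_k^{\mathrm{SAM}})=\frac{\sigma^2}{n}\mathrm{Tr}\left(\left(I-(I-\eta D_1-\eta\rho D_1^2)^k\right)^2\right),$$ $$\mathrm{Var}^-(w_k^{\mathrm{SAM}})=\frac{\sigma^2}{n}\mathrm{Tr}\left(\left(I-(I-\eta D_2-\eta\rho D_2^2)^k\right)^2\right).$$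
   Context: Kernel: $K=K_+-K_-$ where $K_+,K_-:\mathbb{R}^d\times\mathbb{R}^d\to\mathbb{R}$ are positive semidefinite kernels; $K$ is symmetric but possibly indefinite. $\mathcal{H}_K=\mathcal{H}_{K_+}\oplus\mathcal{H}_{K_-}$ is the associated reproducing kernel Krein space of functions on $\mathbb{R}^d$. For fixed $x_1,\dots,x_n\in\mathbb{R}^d$, $K_X=[K(x_i,x_j)]_{i,j}\in\mathbb{R}^{n\times n}$, assumed to have rank $n$. For $w\in\mathbb{R}^n$ write $w^TK(X,\cdot):=\sum_iw_iK(x_i,\cdot)$. Data: $y_i=y_i^*+\epsilon_i$, with $y_i^*=\sum_{j=1}^n\bar w_jK(x_j,x_i)$ for some fixed $\bar w\in\mathbb{R}^n$, and independent noise values with $\mathbb{E}[\epsilon]=0$, $\mathbb{E}[\epsilon\epsilon^T]=\sigma^2I$. Algorithm: for $L[h]=\frac12\sum_{i=1}^n(h(x_i)-y_i)^2$, $h\in\mathcal{H}_K$, the gradient is $\nabla L[h]=\sum_{i=1}^n(h(x_i)-y_i)K(x_i,\cdot)$. KernelSAM with step size $\eta>0$ and $\rho\ge0$ is $h_{k+1}^{\mathrm{SAM}}=h_k^{\mathrm{SAM}}-\eta\nabla L[h_k^{\mathrm{SAM}}+\rho\nabla L[h_k^{\mathrm{SAM}}]]$. When $h_0^{\mathrm{SAM}}=0$, $h_k^{\mathrm{SAM}}=(w_k^{\mathrm{SAM}})^TK(X,\cdot)$, where $w_0^{\mathrm{SAM}}=0$ and $w_{k+1}^{\mathrm{SAM}}=w_k^{\mathrm{SAM}}-\eta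 v(h_k^{\mathrm{SAM}})$ with $v_i(h)=h(x_i)-y_i+\rho\sum_{j=1}^n(h(x_j)-y_j)K(x_i,x_j)$. GD is the case $\rho=0$. Spectral notation: $K_X=UDU^T$ with $U$ orthogonal, $D=\mathrm{diag}(d_1,\dots,d_n)$, $d_1\ge\dots\ge d_n$ (all nonzero); $D_1$ and $D_2$ are the diagonal matrices of the positive and of the negative eigenvalues respectively. With $\Phi(w;x)=\sum_{j=1}^nw_jK(x_j,x)$, for random $w$: $\mathrm{Bias}^2(w)=\frac1n\sum_{i=1}^n(y_i^*-\mathbb{E}_\epsilon[\Phi(w;x_i)])^2$, $\mathrm{Var}(w)=\frac1n\mathbb{E}_\epsilon\left[\sum_{i=1}^n(\Phi(w;x_i)-\mathbb{E}_\epsilon[\Phi(w;x_i)])^2\right]$. *)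

(* Defs.v *)
From HB Require Import structures.
From mathcomp Require Import all_boot all_order all_algebra.
From mathcomp Require Import all_classical all_reals all_analysis.
Set Implicit Arguments.
Unset Strict Implicit.
Unset Printing Implicit Defensive.
Import Order.TTheory GRing.Theory Num.Theory.
Local Open Scope classical_set_scope.
Local Open Scope ring_scope.

Definition psd_kernel (R : realType) (S : Type) (k : S -> S -> R) : Prop :=
  (forall z z' : S, k z z' = k z' z) /\
  (forall (m : nat) (z : 'I_m -> S) (c : 'I_m -> R),
     0 <= \sum_(i < m) \sum_(j < m) c i * c j * k (z i) (z j)).

Section Model.
Variables (R : realType) (S : Type) (n : nat).
Variables (K : S -> S -> R) (x : 'I_n -> S).

Definition gram : 'M[R]_n := \matrix_(i, j) K (x i) (x j).

Definition Phi (w : 'cV[R]_n) (z : S) : R := \sum_(j < n) w j ord0 * K (x j) z.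

(* Gradient of L[h] = 1/2 \sum_i (h (x i) - y i)^2 for the indefinite inner
   product of the reproducing kernel Krein space of K: by the reproducing
   property, evaluation at x i is represented by K (x i). Starting from 0, the
   iterates below never leave the span of the K (x i), so ambient functions
   S -> R suffice. *)
Definition gradL (y : 'cV[R]_n) (h : S -> R) : S -> R :=
  fun z => \sum_(i < n) (h (x i) - y i ord0) * K (x i) z.

Variables (y : 'cV[R]_n) (eta rho : R).

Fixpoint hSAM (k : nat) : S -> R :=
  if k is k'.+1 then
    fun z => hSAM k' z
             - eta * gradL y (fun s => hSAM k' s + rho * gradL y (hSAM k') s) z
  else fun=> 0.

Definition vSAM (h : S -> R) : 'cV[R]_n :=
  \col_(i < n) (h (x i) - y i ord0
                + rho * \sum_(j < n) (h (x j) - y j ord0) * K (x i) (x j)).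

Fixpoint wSAM (k : nat) : 'cV[R]_n :=
  if k is k'.+1 then wSAM k' - eta *: vSAM (hSAM k') else 0.

End Model.

Section Stochastic.
Context {d : measure_display} {T : measurableType d} {R : realType}.
Variable P : probability T R.

Definition independent_RVs (n : nat) (eps : 'I_n -> {RV P >-> R}) : Prop :=
  forall (J : {set 'I_n}) (B : 'I_n -> set R),
    (forall i, measurable (B i)) ->
    P (\bigcap_(i in [set` J]) (eps i @^-1` B i)) =
    (\prod_(i in J) P (eps i @^-1` B i))%E.

(* Bias and variance of a random coefficient vector. They are valued in \bar R,
   so equating them to a real number also asserts finiteness; [fine] only serves
   to subtract the expectation from a real random variable, as in the library's
   covariance. *)
Definition Bias2 (S : Type) (n : nat) (K : S -> S -> R) (x : 'I_n -> S)
    (ystar : 'I_n -> R) (w : T -> 'cV[R]_n) : \bar R :=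
  ((n%:R^-1)%:E *
   \sum_(i < n) ((ystar i)%:E - 'E_P[fun t => Phi K x (w t) (x i)]) ^+ 2)%E.

Definition Var (S : Type) (n : nat) (K : S -> S -> R) (x : 'I_n -> S)
    (w : T -> 'cV[R]_n) : \bar R :=
  ((n%:R^-1)%:E *
   'E_P[fun t => (\sum_(i < n)
          (Phi K x (w t) (x i)
           - fine 'E_P[fun s => Phi K x (w s) (x i)]) ^+ 2)%R])%E.

End Stochastic.

Section SpectralVariance.
Variables (R : realType) (n : nat).

(* Diagonal matrix of the entries of e with index in A, in increasing order of
   index; its size is #|A|, possibly 0. *)
Definition diag_on (e : 'rV[R]_n) (A : {set 'I_n}) : 'M[R]_#|A| :=
  diag_mx (\row_(i < #|A|) e ord0 (enum_val i)).

Definition Dpos (e : 'rV[R]_n) := diag_on e [set i : 'I_n | 0 < e ord0 i]%SET.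
Definition Dneg (e : 'rV[R]_n) := diag_on e [set i : 'I_n | e ord0 i < 0]%SET.

Definition VarPart (eta rho sigma : R) (k m : nat) (D : 'M[R]_m) : R :=
  sigma ^+ 2 / n%:R *
  \tr ((1%:M - (1%:M - eta *: D - (eta * rho) *: (D ^+ 2)) ^+ k) ^+ 2).

Definition VarPos (eta rho sigma : R) (k : nat) (e : 'rV[R]_n) : R :=
  VarPart eta rho sigma k (Dpos e).
Definition VarNeg (eta rho sigma : R) (k : nat) (e : 'rV[R]_n) : R :=
  VarPart eta rho sigma k (Dneg e).

End SpectralVariance.

(* Main.v *)
Require Import Defs.
From HB Require Import structures.
From mathcomp Require Import all_boot all_order all_algebra.
From mathcomp Require Import all_classical all_reals all_analysis.
From mathcomp Require Import ring lra measurable_realfun.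
Set Implicit Arguments.
Unset Strict Implicit.
Unset Printing Implicit Defensive.
Import Order.TTheory GRing.Theory Num.Theory.
Local Open Scope ring_scope.

(* On the sample points the residual of the iterates obeys the linear recursion
   r_(k+1) = M r_k with M = 1 - eta G - eta rho G^2 and r_0 = - y, where G is the
   Gram matrix, so the fitted values are (1 - M^k) y. They are affine in the noise
   with mean (1 - M^k) ystar; hence the bias is |M^k ystar|^2 / n and the variance
   sigma^2 / n times the trace of (1 - M^k)^T (1 - M^k), and both are read off in
   the eigenbasis of G. *)
Section DiagonalMatrices.
Context {R : comNzRingType} {n : nat}.
Implicit Types (a b : 'rV[R]_n) (U : 'M[R]_n).

Lemma exp_diag_mx a k :
  diag_mx a ^+ k = diag_mx (\row_i a ord0 i ^+ k).
Proof.
elim: k => [|k IH]; apply/matrixP => i j.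
  by rewrite expr0 !mxE expr0.
by rewrite exprS IH -[_ * _]/(_ *m _) mulmx_diag !mxE exprS.
Qed.

(** The inner factors [U^T *m U] telescope to the identity, so matrix polynomials in the Gram matrix
    stay diagonal in its eigenbasis. *)
Lemma exp_diag_mx_conj a U k : U *m U^T = 1%:M ->
  (U *m diag_mx a *m U^T) ^+ k = U *m (diag_mx a ^+ k) *m U^T.
Proof.
move=> UUt; have UtU := mulmx1C UUt.
elim: k => [|k IH]; first by rewrite !expr0 mulmx1 UUt.
rewrite exprS IH -[_ * _]/(_ *m _) exprS -[_ * (_ ^+ k)]/(_ *m _) !mulmxA.
by rewrite -(mulmxA _ U^T U) UtU mulmx1.
Qed.

Lemma quad_diag_mx (c1 c2 : R) a :
  1%:M - c1 *: diag_mx a - c2 *: diag_mx a ^+ 2 =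
  diag_mx (\row_i (1 - c1 * a ord0 i - c2 * a ord0 i ^+ 2)).
Proof.
rewrite exp_diag_mx; apply/matrixP => i j; rewrite !mxE.
by case: (i == j); rewrite ?mulr1n ?mulr0n ?mulr0 ?subr0.
Qed.

Lemma sub1_diag_mx a : 1%:M - diag_mx a = diag_mx (\row_i (1 - a ord0 i)).
Proof.
apply/matrixP => i j; rewrite !mxE.
by case: (i == j); rewrite ?mulr1n ?mulr0n ?subr0.
Qed.

Lemma sqnorm_orthogonal U (v : 'cV[R]_n) : U^T *m U = 1%:M ->
  \sum_i (U *m v) i ord0 ^+ 2 = \sum_i v i ord0 ^+ 2.
Proof.
have sqE (z : 'cV[R]_n) : \sum_i z i ord0 ^+ 2 = (z^T *m z) ord0 ord0.
  by rewrite mxE; apply: eq_bigr => i _; rewrite mxE expr2.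
by move=> UtU; rewrite !sqE trmx_mul mulmxA -(mulmxA _ U^T) UtU mulmx1.
Qed.

End DiagonalMatrices.

Section SpectralTrace.
Context {R : realType} {n : nat}.
Implicit Types (eta rho sigma : R) (e : 'rV[R]_n) (A : {set 'I_n}).

Lemma VarPart_diag_mx m eta rho sigma k (a : 'rV[R]_m) :
  VarPart n eta rho sigma k (diag_mx a) = sigma ^+ 2 / n%:R *
  \sum_i (1 - (1 - eta * a ord0 i - eta * rho * a ord0 i ^+ 2) ^+ k) ^+ 2.
Proof.
rewrite /VarPart quad_diag_mx exp_diag_mx sub1_diag_mx exp_diag_mx.
by rewrite mxtrace_diag; congr (_ * _); apply: eq_bigr => i _; rewrite !mxE.
Qed.

(** Each trace is a sum over the indices of one sign; together they recover the full spectral sum,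
    which is the form that the variance computation produces. *)
Lemma VarPosDNeg eta rho sigma k e :
  VarPos eta rho sigma k e + VarNeg eta rho sigma k e = sigma ^+ 2 / n%:R *
  \sum_i (1 - (1 - eta * e ord0 i - eta * rho * e ord0 i ^+ 2) ^+ k) ^+ 2.
Proof.
pose F i := (1 - (1 - eta * e ord0 i - eta * rho * e ord0 i ^+ 2) ^+ k) ^+ 2.
have sumE A : \sum_(i < #|A|) F (enum_val i) = \sum_(i in A) F i.
  by rewrite -big_enum_val.
rewrite /VarPos /VarNeg !VarPart_diag_mx -mulrDr; congr (_ * _).
under eq_bigr do rewrite mxE.
under [X in _ + X]eq_bigr do rewrite mxE.
rewrite !sumE [RHS](bigID (fun i => 0 < e ord0 i)) /=; congr (_ + _).
  by apply: eq_bigl => i; rewrite inE.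
rewrite [RHS](bigID (fun i => e ord0 i < 0)) /= [X in _ + X]big1 ?addr0.
  by apply: eq_bigl => i; rewrite inE; case: ltgtP.
(* A zero eigenvalue contributes 1 - 1 ^ k = 0. *)
move=> i; rewrite -!leNgt => /andP[le0 ge0].
have -> : e ord0 i = 0 by apply/eqP; rewrite eq_le le0.
by rewrite /F expr0n !mulr0 !subr0 expr1n subrr expr0n.
Qed.

End SpectralTrace.

Section Iterates.
Context {R : realType} {S : Type} {n : nat}.
Variables (K : S -> S -> R) (x : 'I_n -> S) (eta rho : R).
Hypothesis K_sym : forall z z', K z z' = K z' z.
Implicit Types (w y : 'cV[R]_n).

Local Notation G := (gram K x).

Lemma PhiBZ w v (c : R) z :
  Phi K x (w - c *: v) z = Phi K x w z - c * Phi K x v z.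
Proof.
rewrite /Phi mulr_sumr -sumrB; apply: eq_bigr => j _.
by rewrite !mxE mulrBl mulrA.
Qed.

(** The gradient at the perturbed function is a combination of the [K (x i)] whose coefficients are
    the entries of [vSAM], so the functional and the coefficient recursions agree step by step.
    Symmetry reconciles [K (x j) (x i)] in [gradL] with [K (x i) (x j)] in [vSAM]. *)
Lemma hSAM_Phi y k z :
  hSAM K x y eta rho k z = Phi K x (wSAM K x y eta rho k) z.
Proof.
elim: k z => [|k IH] z /=.
  by rewrite /Phi big1 // => j _; rewrite mxE mul0r.
rewrite PhiBZ IH; congr (_ - _ * _).
apply: eq_bigr => i _; rewrite mxE addrAC; congr (_ * _).
by congr (_ + _ * _); apply: eq_bigr => j _; rewrite [K (x j) _]K_sym.
Qed.

Lemma PhiE w i : Phi K x w (x i) = (G *m w) i ord0.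
Proof.
by rewrite mxE; apply: eq_bigr => j _; rewrite mxE mulrC K_sym.
Qed.

Lemma vSAM_residual y k : let r := G *m wSAM K x y eta rho k - y in
  vSAM K x y rho (hSAM K x y eta rho k) = r + rho *: (G *m r).
Proof.
apply/colP => i; rewrite !mxE hSAM_Phi PhiE !mxE; congr (_ + _ * _).
by apply: eq_bigr => j _; rewrite hSAM_Phi PhiE !mxE mulrC.
Qed.

Lemma wSAM_residual y k :
  G *m wSAM K x y eta rho k - y =
  - ((1%:M - eta *: G - (eta * rho) *: G ^+ 2) ^+ k *m y).
Proof.
elim: k => [|k IH]; first by rewrite mulmx0 expr0 mul1mx sub0r.
rewrite [wSAM _ _ _ _ _ _]/= vSAM_residual; set r := _ - y in IH *.
(* Applying [G] to the update gives the new residual r - eta G (r + rho G r), which is linear in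
   r. *)
transitivity ((1%:M - eta *: G - (eta * rho) *: G ^+ 2) *m r).
  rewrite expr2 -[G * G]/(G *m G) !mulmxBl mul1mx -!scalemxAl -mulmxA.
  rewrite mulmxBr -scalemxAr mulmxDr -scalemxAr scalerDr scalerA.
  by rewrite /r addrAC opprD addrA.
by rewrite IH mulmxN mulmxA [_ ^+ k.+1]exprS.
Qed.

End Iterates.

Section Moments.
Context {d : measure_display} {T : measurableType d} {R : realType}.
Variable P : probability T R.

(** The index type is arbitrary because the lemma serves both for noise coordinates and for pairs of
    them. *)
Lemma expectation_linear_comb (I : finType) (c : I -> R) (f : I -> T -> R) :
  (forall i, P.-integrable setT (EFin \o f i)) ->
  ('E_P[fun t => (\sum_i c i * f i t)%R] = \sum_i (c i)%:E * 'E_P[f i])%E.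
Proof.
move=> intf; rewrite unlock.
under eq_integral do (rewrite -sumEFin; under eq_bigr do rewrite EFinM).
rewrite (@integral_sum _ _ _ _ _ _ _ (fun i t => (c i)%:E * (f i t)%:E)%E) //; last first.
  by move=> i; apply: integrableZl => //; exact: intf.
by apply: eq_bigr => i _; rewrite integralZl //; exact: intf.
Qed.

Context {n : nat}.
Variables (sigma : R) (eps : 'I_n -> {RV P >-> R}).
Hypothesis eps_mean : forall i, ('E_P[eps i] = 0)%E.
Hypothesis eps_cov : forall i j,
  ('E_P[fun t => (eps i t * eps j t)%R] = (sigma ^+ 2 *+ (i == j))%R%:E)%E.

(** A finite integral forces the positive and negative parts to have finite integrals, so the moment
    hypotheses already carry integrability. *)
Lemma integrable_sqr_noise i :
  P.-integrable setT (EFin \o (fun t => eps i t * eps i t)).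
Proof.
have mf : measurable_fun setT (fun t => eps i t * eps i t).
  by exact: measurable_funM.
apply/integrableP; split; first exact/measurable_EFinP.
rewrite integral_fin_num_abs //.
by have := eps_cov i i; rewrite unlock => ->.
Qed.

(** Domination by a sum of squares: |ab| is at most a^2 + b^2, from (|a| - |b|)^2 >= 0. *)
Lemma integrable_prod_noise i j :
  P.-integrable setT (EFin \o (fun t => eps i t * eps j t)).
Proof.
pose g t := ((eps i t * eps i t)%:E + (eps j t * eps j t)%:E)%E.
apply: (le_integrable measurableT _ _ (g := g)).
- by apply/measurable_EFinP; exact: measurable_funM.
- move=> t _; rewrite /g -EFinD /= lee_fin normrM -!expr2.
  rewrite [leRHS]ger0_norm ?addr_ge0 ?sqr_ge0 //.
  rewrite -[eps i t ^+ 2]real_normK ?num_real // -[eps j t ^+ 2]real_normK ?num_real //.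
  by have := sqr_ge0 (`|eps i t| - `|eps j t|); nra.
- by apply: integrableD => //; exact: integrable_sqr_noise.
Qed.

Lemma integrable_noise i : P.-integrable setT (EFin \o eps i).
Proof.
apply/integrableP; split; first exact/measurable_EFinP.
by rewrite integral_fin_num_abs //; have := eps_mean i; rewrite unlock => ->.
Qed.

Lemma expectation_affine_noise (b : R) (c : 'I_n -> R) :
  ('E_P[fun t => (b + \sum_j c j * eps j t)%R] = b%:E)%E.
Proof.
have int_sum : P.-integrable setT (EFin \o (fun t => \sum_j c j * eps j t)).
  rewrite (_ : _ \o _ = fun t => \sum_j (c j)%:E * (eps j t)%:E)%E.
    by apply: integrable_sum => // j _; apply: integrableZl => //; exact: integrable_noise.
  by apply/funext => t /=; rewrite -sumEFin.
rewrite (_ : (fun _ => _) = cst b \+ (fun t => \sum_j c j * eps j t)) //.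
rewrite expectationD ?expectation_cst; last 2 first.
- by rewrite inE; apply/Lfun1_integrable; exact: finite_measure_integrable_cst.
- by rewrite inE; apply/Lfun1_integrable.
rewrite expectation_linear_comb; last exact: integrable_noise.
by rewrite big1 ?adde0 // => j _; rewrite eps_mean mule0.
Qed.

(** The squared norm is the quadratic form of [A^T *m A] in the noise; since the covariance is
    sigma^2 times the identity, only the diagonal terms survive in the mean. *)
Lemma expectation_sqnorm_noise (A : 'M[R]_n) :
  ('E_P[fun t => (\sum_i (\sum_j A i j * eps j t) ^+ 2)%R] =
    (sigma ^+ 2 * \tr (A^T *m A))%:E)%E.
Proof.
transitivity ('E_P[fun t => (\sum_(p : 'I_n * 'I_n)
    (A^T *m A) p.1 p.2 * (eps p.1 t * eps p.2 t))%R])%E.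
  congr expectation; apply/funext => t.
  under eq_bigr do rewrite expr2 big_distrlr /=.
  rewrite exchange_big /=; under eq_bigr do rewrite exchange_big /=.
  rewrite pair_big; apply: eq_bigr => -[j l] _ /=.
  rewrite mxE mulr_suml; apply: eq_bigr => i _; rewrite mxE; ring.
rewrite expectation_linear_comb; last by move=> p; exact: integrable_prod_noise.
under eq_bigr do rewrite eps_cov -EFinM.
rewrite sumEFin -(pair_big xpredT xpredT
  (fun i j => (A^T *m A) i j * (sigma ^+ 2 *+ (i == j)))) /=.
congr _%:E; rewrite mulr_sumr; apply: eq_bigr => i _.
rewrite (bigD1 i) //= eqxx mulr1n big1 ?addr0 1?mulrC // => j ji.
by rewrite eq_sym (negbTE ji) mulr0n mulr0.
Qed.

End Moments.

Theorem theorem4 (R : realType) (p n : nat) (n_gt0 : (0 < n)%N)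
  (K Kp Km : 'rV[R]_p -> 'rV[R]_p -> R)
  (Kp_psd : psd_kernel Kp) (Km_psd : psd_kernel Km)
  (K_def : forall z z', K z z' = Kp z z' - Km z z')
  (x : 'I_n -> 'rV[R]_p) (rankK : \rank (gram K x) = n)
  (disp : measure_display) (T : measurableType disp) (P : probability T R)
  (sigma : R) (eps : 'I_n -> {RV P >-> R})
  (eps_indep : independent_RVs eps)
  (eps_mean : forall i, ('E_P[eps i] = 0)%E)
  (eps_cov : forall i j,
     ('E_P[fun t => (eps i t * eps j t)%R] = (sigma ^+ 2 *+ (i == j))%R%:E)%E)
  (wbar : 'cV[R]_n) (ystar : 'I_n -> R)
  (ystarE : forall i, ystar i = Phi K x wbar (x i))
  (y : T -> 'cV[R]_n)
  (yE : forall t i, y t i ord0 = ystar i + eps i t)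
  (eta rho : R) (eta_gt0 : 0 < eta) (rho_ge0 : 0 <= rho)
  (U : 'M[R]_n) (e : 'rV[R]_n)
  (U_orth : U *m U^T = 1%:M)
  (K_spec : gram K x = U *m diag_mx e *m U^T)
  (e_sorted : forall i j : 'I_n, (i <= j)%N -> e ord0 j <= e ord0 i)
  (u : 'cV[R]_n) (uE : u = U^T *m wbar)
  (k : nat) :
  let w := fun t => wSAM K x (y t) eta rho k in
  [/\ Var P K x w
        = (VarPos eta rho sigma k e + VarNeg eta rho sigma k e)%:E
    & Bias2 P K x ystar w
        = (n%:R^-1 * \sum_(i < n)
             (1 - eta * e ord0 i - eta * rho * e ord0 i ^+ 2) ^+ (2 * k)
             * e ord0 i ^+ 2 * u i ord0 ^+ 2)%:E].
Proof.
move=> w.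
have K_sym z z' : K z z' = K z' z.
  by rewrite !K_def; have [-> _] := Kp_psd; have [-> _] := Km_psd.
pose G := gram K x; pose ys : 'cV[R]_n := \col_i ystar i.
pose m : 'rV[R]_n := \row_i (1 - eta * e ord0 i - eta * rho * e ord0 i ^+ 2).
pose M := 1%:M - eta *: G - (eta * rho) *: G ^+ 2.
have UtU := mulmx1C U_orth.
have ME : M ^+ k = U *m diag_mx m ^+ k *m U^T.
  rewrite -(exp_diag_mx_conj _ _ U_orth) -quad_diag_mx /M /G K_spec; congr (_ ^+ _).
  rewrite exp_diag_mx_conj // !(mulmxBr, mulmxBl) mulmx1 U_orth.
  by rewrite -!(scalemxAl, scalemxAr).
(* The clean targets are the Gram matrix applied to [wbar]. *)
have ysE : ys = U *m (diag_mx e *m u).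
  rewrite uE !mulmxA -K_spec; apply/colP => i.
  by rewrite mxE ystarE PhiE.
pose A := 1%:M - M ^+ k.
have PhiwE t i : Phi K x (w t) (x i) =
    (A *m ys) i ord0 + \sum_j A i j * eps j t.
  (* Adding [y t] back to the residual turns the fitted values into [A *m y t]; splitting [y t] into
     [ys] plus noise separates the mean from the fluctuation. *)
  rewrite PhiE //; have /(canRL (subrK _)) -> := wSAM_residual x eta rho K_sym (y t) k.
  have -> : y t = ys + \col_j eps j t by apply/colP => j; rewrite !mxE yE.
  rewrite addrC -/M -[X in X - _]mul1mx -mulmxBl mulmxDr mxE; congr (_ + _).
  by rewrite mxE; apply: eq_bigr => j _; congr (_ * _); rewrite mxE.
have EPhi i : ('E_P[fun t => Phi K x (w t) (x i)] = ((A *m ys) i ord0)%:E)%E.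
  under eq_fun do rewrite PhiwE.
  exact: expectation_affine_noise.
have AE : A = U *m (1%:M - diag_mx m ^+ k) *m U^T.
  by rewrite mulmxBr mulmxBl mulmx1 U_orth -ME.
split.
- rewrite /Var VarPosDNeg.
  (* Centering cancels [A *m ys] and leaves the entries of [A] applied to the noise. *)
  under [X in expectation _ X]eq_fun => t.
    under eq_bigr => i _ do rewrite EPhi /= PhiwE addrAC subrr add0r.
    over.
  rewrite (expectation_sqnorm_noise eps_cov) -EFinM; congr _%:E.
  rewrite mulrCA mulrA; congr (_ * _).
  (* Cyclicity of the trace brings the outer [U] and [U^T] together, leaving the trace of a squared
     diagonal matrix. *)
  rewrite AE !trmx_mul trmxK !mulmxA mxtrace_mulC !mulmxA UtU mul1mx.
  rewrite -(mulmxA _ U^T U) UtU mulmx1 exp_diag_mx sub1_diag_mx tr_diag_mx.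
  rewrite mulmx_diag mxtrace_diag; apply: eq_bigr => i _.
  by rewrite !mxE expr2.
- rewrite /Bias2; under eq_bigr => i _ do rewrite EPhi -EFinB -EFin_expe.
  rewrite sumEFin -EFinM; congr (_ * _)%:E.
  (* The bias vector is [ys - A *m ys], that is [M ^+ k *m ys]; in the eigenbasis only one leading
     [U] remains, and it preserves the norm. *)
  transitivity (\sum_i (U *m (diag_mx m ^+ k *m (diag_mx e *m u))) i ord0 ^+ 2).
    apply: eq_bigr => i _; congr (_ ^+ _).
    transitivity ((ys - A *m ys) i ord0); first by rewrite !mxE.
    rewrite mulmxBl mul1mx opprB addrC subrK ME ysE -!mulmxA.
    by rewrite (mulmxA U^T) UtU mul1mx.
  rewrite sqnorm_orthogonal //; apply: eq_bigr => i _.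
  by rewrite exp_diag_mx !mul_diag_mx !mxE !exprMn mulnC exprM mulrA.
Qed.
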